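(* (Profile likelihood.) Let $\alpha\in(0,1)$, let $(P_\theta:\theta\in\Theta)$ be a collection of distributions with densities $p_\theta$ with respect to a common measure $\mu$, and let $\psi=g(\theta)$ be a function of the parameter. Let $Y_1,\dots,Y_{2n}$ be i.i.d. from $P_{\theta^*}$, $\theta^*\in\Theta$, split into two groups $D_0,D_1$ of size $n$, let $\widehat\theta_1$ be any estimator constructed from $D_1$, and let $C_n=\{\theta\in\Theta:\mathcal L_0(\widehat\theta_1)/\mathcal L_0(\theta)\le 1/\alpha\}$. Then $$B_n=\{\psi:\ C_n\cap g^{-1}(\psi)\ne\emptyset\}$$ is a $1-\alpha$ confidence set for $\psi$, i.e. $P_{\theta^*}(g(\theta^* )\in B_n)\ge 1-\alpha$. Moreover, with the profile likelihood function $$\mathcal L_0^\dagger(\psi)=\sup_{\theta:\,g(\theta)=\psi}\mathcal L_0(\theta),$$ the set $B_n$ can be rewritten as $$B_n=\left\{\psi:\ \frac{\mathcal L_0(\widehat\theta_1)}{\mathcal L_0^\dagger(\psi)}\le\frac1\alpha\right\}.$$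
   Context: $\theta^*$ is the true parameter value. The data are split at random into $D_0$ and $D_1$. $\mathcal L_0(\theta)=\prod_{i\in D_0}p_\theta(Y_i)$ is the likelihood based on $D_0$, and $g^{-1}(\psi)=\{\theta:g(\theta)=\psi\}$.
   Formalization: The rewriting of B_n fails if the ratio equals 1/α at a ψ whose supremum is not attained; equality is proved when the supremum is attained at each such ψ (inclusion of B_n always), with ψ ranging over values of g, and the estimator's fitted density is assumed jointly measurable. *)

(* Defs.v *)
From HB Require Import structures.
From mathcomp Require Import all_boot all_order all_algebra.
From mathcomp Require Import all_classical all_reals all_analysis.

Set Implicit Arguments.
Unset Strict Implicit.
Unset Printing Implicit Defensive.

Import Order.TTheory GRing.Theory Num.Theory.

Local Open Scope classical_set_scope.
Local Open Scope ring_scope.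

Definition is_density d (T : measurableType d) (R : realType)
    (mu : {measure set T -> \bar R}) (Q : probability T R) (f : T -> R) : Prop :=
  [/\ measurable_fun [set: T] f,
      forall x, 0 <= f x &
      forall A, measurable A -> Q A = (\int[mu]_(x in A) (f x)%:E)%E].

Definition mutually_independent d d' (Omega : measurableType d)
    (T : measurableType d') (R : realType) (P : probability Omega R)
    (I : finType) (X : I -> {RV P >-> T}) : Prop :=
  forall (J : {set I}) (A : I -> set T), (forall i, measurable (A i)) ->
    P (\bigcap_(i in [set` J]) (X i @^-1` A i))
    = (\prod_(i in J) P (X i @^-1` A i))%E.

Definition iid_from d d' (Omega : measurableType d) (T : measurableType d')
    (R : realType) (P : probability Omega R) (I : finType)
    (X : I -> {RV P >-> T}) (Q : probability T R) : Prop :=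
  mutually_independent X /\
  forall i A, measurable A -> distribution P (X i) A = Q A.

(* D is the (random) set of indices forming the first half of the data; its law
   on the n-subsets is arbitrary, so deterministic splits are included. *)
Definition independent_split d d' (Omega : measurableType d)
    (T : measurableType d') (R : realType) (P : probability Omega R) (n : nat)
    (Y : 'I_(2 * n) -> {RV P >-> T}) (D : Omega -> {set 'I_(2 * n)}) : Prop :=
  [/\ forall w, #|D w| = n,
      forall S, measurable (D @^-1` [set S]) &
      forall S (B : set ((2 * n).-tuple T)), measurable B ->
        P (D @^-1` [set S] `&` [set w | B [tuple Y i w | i < 2 * n]])
        = (P (D @^-1` [set S]) * P [set w | B [tuple Y i w | i < 2 * n]])%E].

(* An estimator takes a group of indices together with the observations of that
   group, listed by increasing index. *)
Definition estimate (T Theta : Type) (m : nat)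
    (est : {set 'I_m} -> seq T -> Theta) (y : 'I_m -> T) (D : {set 'I_m}) :
    Theta :=
  est D [seq y i | i <- enum D].

(* Theta carries no sigma-algebra: what is asked of an estimator is that its
   fitted density be jointly measurable in the n observations it is computed
   from and in the point where it is evaluated. *)
Definition measurable_estimator d (T : measurableType d) (R : realType)
    (Theta : Type) (p : Theta -> T -> R) (n : nat)
    (est : {set 'I_(2 * n)} -> seq T -> Theta) : Prop :=
  forall S : {set 'I_(2 * n)}, #|S| = n ->
    measurable_fun [set: n.-tuple T * T] (fun z => p (est S z.1) z.2).

Section split_likelihood.
Context {T Theta Psi : Type} {R : realType} {m : nat}.
Variables (p : Theta -> T -> R) (g : Theta -> Psi) (alpha : R).
Variables (y : 'I_m -> T) (D0 : {set 'I_m}) (hattheta1 : Theta).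

Definition likelihood (theta : Theta) : R := \prod_(i in D0) p theta (y i).

(* Ratios are taken in \bar R, where a / 0 = +oo for a > 0, 0 / 0 = 0 and
   a / +oo = 0; hence a / b <= 1 / alpha means alpha * a <= b for a, b >= 0. *)
Definition split_LRT_set : set Theta :=
  [set theta | ((likelihood hattheta1)%:E / (likelihood theta)%:E
                <= (1 / alpha)%:E)%E].

Definition profile_set : set Psi :=
  [set psi | split_LRT_set `&` g @^-1` [set psi] !=set0].

Definition profile_likelihood (psi : Psi) : \bar R :=
  ereal_sup [set (likelihood theta)%:E | theta in g @^-1` [set psi]].

Definition profile_ratio (psi : Psi) : \bar R :=
  ((likelihood hattheta1)%:E / profile_likelihood psi)%E.

(* psi ranges over the values of g: off range g the supremum is over the empty
   set, hence -oo in \bar R. *)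
Definition profile_LRT_set : set Psi :=
  [set psi | range g psi /\ (profile_ratio psi <= (1 / alpha)%:E)%E].

Definition profile_attained (psi : Psi) : Prop :=
  exists2 theta, g theta = psi
               & (likelihood theta)%:E = profile_likelihood psi.

End split_likelihood.

(* A confidence event such as {w | psi \in B_n w} is an uncountable union over
   a fibre of g and need not be measurable. *)
Definition inner_probability d (Omega : measurableType d) (R : realType)
    (P : probability Omega R) (E : set Omega) : \bar R :=
  ereal_sup [set P A | A in [set A | measurable A /\ A `<=` E]].

Lemma inner_probabilityE d (Omega : measurableType d) (R : realType)
    (P : probability Omega R) (E : set Omega) :
  measurable E -> inner_probability P E = P E.
Proof.
move=> mE; apply/eqP; rewrite eq_le; apply/andP; split.
  apply: ge_ereal_sup => _ [A [mA AE] <-].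
  by apply: le_measure => //; rewrite inE.
by apply: ereal_sup_ubound; exists E => //; split.
Qed.

(* Main.v *)
Require Import Defs.
From HB Require Import structures.
From mathcomp Require Import all_boot all_order all_algebra.
From mathcomp Require Import all_classical all_reals all_analysis.
From mathcomp Require Import measurable_realfun.

(* Write L for the likelihood of the data in D0 and r for the ratio of the
   fitted density to the true one. Given the data in D1, the factors r(Y_i),
   i in D0, are independent with mean at most 1, so L(hattheta1)/L(thetastar)
   has expectation at most 1, and Markov's inequality bounds by alpha the
   probability that thetastar is not in C_n. Since mu need not be sigma-finite,
   Fubini's theorem is applied to the law of the data, never to mu: mu enters
   only through the integral of r over a single observation. The conditioning
   on D1 is replaced by redrawing the D0-coordinates one at a time from the true
   distribution, which does not change the law of the data. *)

Set Implicit Arguments.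
Unset Strict Implicit.
Unset Printing Implicit Defensive.

Import Order.TTheory GRing.Theory Num.Theory.

Local Open Scope classical_set_scope.
Local Open Scope ring_scope.

(** * Measurability of quotients and of products over coordinates *)

Lemma measurable_fun_divr_ge0 d (T : measurableType d) (R : realType)
    (D : set T) (f g : T -> R) : (forall x, 0 <= g x) ->
  measurable_fun D f -> measurable_fun D g ->
  measurable_fun D (fun x => f x / g x).
Proof.
move=> g0 mf mg.
(* On nonnegative reals, 0 included, inversion is the real power of exponent -1, which is
   measurable. *)
rewrite (_ : (fun x => _) = fun x => f x * g x `^ (- 1)); last first.
  by apply/funext => x; rewrite powR_inv1.
apply: measurable_funM => //; exact: (measurableT_comp (measurable_powR _)).
Qed.

(** [f] also receives the whole tuple because the fitted density depends on the data. *)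
Lemma measurable_prod_tnth d (T : measurableType d) (R : realType) (m : nat)
    (f : m.-tuple T -> T -> R) (S : {set 'I_m}) :
  measurable_fun [set: m.-tuple T * T] (fun z => f z.1 z.2) ->
  measurable_fun setT (fun t : m.-tuple T => \prod_(i in S) f t (tnth t i)).
Proof.
move=> mf; under eq_fun do rewrite big_mkcond/=.
apply: measurable_prod => i _; case: (i \in S) => //.
apply: (@measurableT_comp _ _ _ _ _ _ (fun z : m.-tuple T * T => f z.1 z.2)
  _ (fun t => (t, tnth t i))) => //.
by apply: measurable_fun_pair => //; exact: measurable_tnth.
Qed.

(** * Integration against a density and the mean of the likelihood ratio *)

Section density.
Local Open Scope ereal_scope.
Context d (T : measurableType d) (R : realType) (mu : {measure set T -> \bar R}).

Import HBNNSimple.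

Let integral_density_nnsfun (Q : probability T R) (p : T -> R)
    (h : {nnsfun T >-> R}) : is_density mu Q p ->
  \int[Q]_x (h x)%:E = \int[mu]_x ((h x)%:E * (p x)%:E).
Proof.
move=> [mp p0 Qp].
rewrite integralT_nnsfun sintegralE.
under [RHS]eq_integral.
  move=> x _; rewrite fimfunE -fsumEFin// ge0_mule_fsuml; last first.
    by move=> r; rewrite EFinM nnfun_muleindic_ge0.
  over.
rewrite ge0_integral_fsum//; last 2 first.
  - move=> r; apply: emeasurable_funM; last exact/measurable_EFinP.
    by apply/measurable_EFinP; apply/measurableT_comp.
  - move=> r x _; rewrite mule_ge0 ?lee_fin//.
    by rewrite -lee_fin EFinM nnfun_muleindic_ge0.
apply: eq_fsbigr => r; rewrite inE => -[t _ htr].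
have r0 : (0 <= r)%R by rewrite -htr.
rewrite [X in _ * X](Qp _ _)//.
under [RHS]eq_integral do rewrite EFinM -muleA.
rewrite ge0_integralZl//; last 2 first.
  - apply: emeasurable_funM; last exact/measurable_EFinP.
    exact/measurable_EFinP.
  - by move=> x _; rewrite mule_ge0 ?lee_fin.
congr (_ * _); rewrite integral_mkcond; apply: eq_integral => x _.
by rewrite patchE indicE; case: ifPn => _ /=; rewrite (mul1e,mul0e).
Qed.

(** Simple functions increasing to [f], with monotone convergence on both sides, reduce the claim to
    [integral_density_nnsfun]. *)
Lemma ge0_integral_density (Q : probability T R) (p : T -> R)
    (f : T -> \bar R) : is_density mu Q p ->
    measurable_fun setT f -> (forall x, 0 <= f x) ->
  \int[Q]_x f x = \int[mu]_x (f x * (p x)%:E).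
Proof.
move=> Qp mf f0; have [mp p0 _] := Qp.
pose h := nnsfun_approx measurableT mf.
have cvgh x : EFin \o h^~ x @ \oo --> f x.
  by apply: cvg_nnsfun_approx.
have ndh x : nondecreasing_seq (fun n => (h n x)%:E).
  by move=> a b ab; rewrite lee_fin; exact/lefP/nd_nnsfun_approx.
transitivity (limn (fun n => \int[Q]_x (h n x)%:E)).
  rewrite -monotone_convergence//.
  - by apply: eq_integral => x _; apply/esym/cvg_lim => //; exact: cvgh.
  - by move=> n; exact/measurable_EFinP.
  - by move=> n x _; rewrite lee_fin.
under eq_fun do rewrite (integral_density_nnsfun _ Qp).
rewrite -monotone_convergence//.
- apply: eq_integral => x _; apply/cvg_lim => //.
  apply: cvgeZr => //; exact: cvgh.
- move=> n; apply: emeasurable_funM; exact/measurable_EFinP.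
- by move=> n x _; rewrite mule_ge0 ?lee_fin.
- by move=> x _ a b ab; rewrite lee_wpmul2r ?lee_fin// -lee_fin; exact: ndh.
Qed.

(** Makes the true density nonzero at almost every observation, so that denominators can be
    cleared. *)
Lemma density_null (Q : probability T R) (p : T -> R) : is_density mu Q p ->
  Q [set x | p x = 0%R] = 0.
Proof.
move=> [mp p0 Qp]; rewrite Qp.
  by rewrite integral0_eq// => x /= ->.
by rewrite -[X in measurable X]setTI; exact: (mp measurableT [set 0%R]).
Qed.

(* Not an equality: [p1 x / 0 = 0] drops the mass of [Q1] on [p0 = 0]. *)
Lemma integral_likelihood_ratio_le1 (Q0 Q1 : probability T R) (p0 p1 : T -> R) :
  is_density mu Q0 p0 -> is_density mu Q1 p1 ->
  \int[Q0]_x (p1 x / p0 x)%:E <= 1.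
Proof.
move=> Qp0 Qp1; have [mp0 p0_ge0 _] := Qp0; have [mp1 p1_ge0 Q1E] := Qp1.
have mr := measurable_fun_divr_ge0 p0_ge0 mp1 mp0.
rewrite (ge0_integral_density Qp0)//; last 2 first.
- exact/measurable_EFinP.
- by move=> x; rewrite lee_fin divr_ge0.
rewrite -(probability_setT Q1) Q1E//; apply: ge0_le_integral => //.
- by move=> x _; rewrite mule_ge0// lee_fin ?divr_ge0.
- apply: emeasurable_funM; exact/measurable_EFinP.
- exact/measurable_EFinP.
- move=> x _; rewrite -EFinM lee_fin.
  have [->|p0x] := eqVneq (p0 x) 0%R; first by rewrite mulr0.
  by rewrite divfK.
Qed.

End density.

(** * I.i.d. laws on tuples and the redrawing of coordinates *)

Definition box (T : Type) (m : nat) (A : 'I_m -> set T) : set (m.-tuple T) :=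
  [set t | forall i, A i (tnth t i)].

(** Values on rectangles determine a probability, by [eq_measure_box]; so for a probability [nu]
    this says that it is the [m]-fold product of [Q]. *)
Definition is_iid_law d (T : measurableType d) (R : realType) (m : nat)
    (nu : set (m.-tuple T) -> \bar R) (Q : probability T R) : Prop :=
  forall A : 'I_m -> set T, (forall i, measurable (A i)) ->
    nu (box A) = (\prod_(i < m) Q (A i))%E.

(** [z.2] is a fresh observation; taking a pair makes the redrawn tuple a random variable on the
    product space. *)
Definition resample (T : Type) (m : nat) (i : 'I_m) (z : m.-tuple T * T) :
    m.-tuple T :=
  [tuple if j == i then z.2 else tnth z.1 j | j < m].

Section tuple_law.
Local Open Scope ereal_scope.
Context d (T : measurableType d) (R : realType) (m : nat).

Lemma measurable_box (A : 'I_m -> set T) :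
  (forall i, measurable (A i)) -> measurable (box A).
Proof.
move=> mA; rewrite (_ : box A =
    \big[setI/setT]_(i < m) ((fun t => tnth t i) @^-1` A i)).
  apply: bigsetI_measurable => i _; rewrite -[X in measurable X]setTI.
  exact: measurable_tnth.
rewrite -bigcap_seq; apply/seteqP; split=> t /= At i.
  by move=> _; exact: At.
by apply: At; rewrite /= mem_index_enum.
Qed.

(** Rectangles are stable under intersection and generate the sigma-algebra of the tuples, so finite
    measures that agree on them coincide. *)
Lemma eq_measure_box (m1 m2 : {measure set (m.-tuple T) -> \bar R}) :
  m1 setT < +oo ->
  (forall A : 'I_m -> set T, (forall i, measurable (A i)) ->
     m1 (box A) = m2 (box A)) ->
  forall B, measurable B -> m1 B = m2 B.
Proof.
move=> m1oo m12 B mB.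
pose G : set (set (m.-tuple T)) :=
  [set box A | A in [set A : 'I_m -> set T | forall i, measurable (A i)]].
have boxT : box (fun=> setT) = setT :> set (m.-tuple T).
  by apply/seteqP; split.
apply: (measure_unique G (fun=> setT)) => //.
- apply/seteqP; split; last first.
    apply: smallest_sub; first exact: sigma_algebra_measurable.
    by move=> _ [A mA <-]; exact: measurable_box.
  apply: smallest_sub; first exact: smallest_sigma_algebra.
  move=> C; rewrite -bigcup_seq/= => -[i _ [D mD <-]].
  apply: sub_sigma_algebra.
  (* A cylinder over one coordinate is the rectangle whose other sides are full. *)
  exists (fun j => if j == i then D else setT) => [j /=|].
    by case: ifP.
  apply/seteqP; split=> t /= => [/(_ i)|[_ Dt] j]; first by rewrite eqxx.
  by case: eqP => [->|].
- move=> _ _ [A mA <-] [A' mA' <-]; exists (fun i => A i `&` A' i) => [i|].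
    exact: measurableI.
  apply/seteqP; split=> t /= => [AA'|[At A't] i]; last by split.
  by split=> i; have [] := AA' i.
- by move=> _; exists (fun=> setT).
- by rewrite bigcup_const.
- by move=> _ [A mA <-]; exact: m12.
Qed.

Lemma measurable_resample (i : 'I_m) :
  measurable_fun [set: m.-tuple T * T] (resample i).
Proof.
apply/measurable_fun_tnthP => j.
rewrite (_ : _ \o _ = fun z : m.-tuple T * T =>
    if j == i then z.2 else tnth z.1 j); last first.
  by apply/funext => z; rewrite /= tnth_mktuple.
case: eqP => _; first exact: measurable_snd.
apply: (@measurableT_comp _ _ _ _ _ _ (fun t : m.-tuple T => tnth t j)) => //.
exact: measurable_tnth.
Qed.

HB.instance Definition _ i :=
  isMeasurableFun.Build _ _ _ _ (resample i) (measurable_resample i).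

(** Under [nu \x Q] the redrawn tuple again has law [nu], as is seen on rectangles; Tonelli's
    theorem then separates the two integrals. *)
Lemma integral_resample (nu : probability (m.-tuple T) R) (Q : probability T R)
    (i : 'I_m) (f : m.-tuple T -> \bar R) :
  is_iid_law nu Q -> measurable_fun setT f -> (forall t, 0 <= f t) ->
  \int[nu]_t f t = \int[nu]_t \int[Q]_x f (resample i (t, x)).
Proof.
move=> nuQ mf f0.
have mfr : measurable_fun setT (f \o resample i) by exact: measurableT_comp.
transitivity (\int[nu \x Q]_z f (resample i z)); last first.
  by rewrite (fubini_tonelli1 _ mfr)// => z; exact: f0.
rewrite -(ge0_integral_distribution (P := (nu \x Q)%E) (resample i))//.
apply: eq_measure_integral => B mB _.
apply: (eq_measure_box (m2 := distribution (nu \x Q)%E (resample i))) => //.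
  by rewrite [ltLHS](probability_setT nu) ltry.
move=> A mA.
(* The preimage of a rectangle frees side [i] of the tuple and puts the constraint [A i] on the
   fresh observation. *)
transitivity ((nu \x Q)
    (box (fun j => if j == i then setT else A j) `*` A i)); last first.
  congr ((nu \x Q) _); apply/seteqP.
  split=> -[t x]/= => [[At Ax] j|At].
    rewrite tnth_mktuple; case: eqP => [->//|/eqP/negbTE ji].
    by have := At j; rewrite ji.
  split=> [j|]; last by have := At i; rewrite tnth_mktuple eqxx.
  by have := At j; rewrite tnth_mktuple; case: eqP.
have mA' j : measurable (if j == i then setT else A j) by case: ifP.
rewrite product_measure1E//; last exact: measurable_box.
rewrite [LHS]nuQ// [X in _ = X * _]nuQ// (bigD1 i)//= [in RHS](bigD1 i)//=.
rewrite eqxx probability_setT mul1e muleC; congr (_ * _).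
by apply: eq_bigr => j /negbTE ->.
Qed.

(* Integrating out the coordinates in [K] one at a time: each one contributes a
   factor [\int[Q]_x r t x <= 1], and the others do not see it. *)
Lemma integral_prod_le1 (nu : probability (m.-tuple T) R) (Q : probability T R)
    (r : m.-tuple T -> T -> R) (S : {set 'I_m}) :
  is_iid_law nu Q ->
  measurable_fun [set: m.-tuple T * T] (fun z => r z.1 z.2) ->
  (forall t x, (0 <= r t x)%R) ->
  (forall t, \int[Q]_x (r t x)%:E <= 1) ->
  (forall i t x, i \in S -> r (resample i (t, x)) = r t) ->
  forall K : {set 'I_m}, K \subset S ->
    \int[nu]_t (\prod_(i in K) r t (tnth t i))%:E <= 1.
Proof.
move=> nuQ mr r0 intr rS K.
have mh (K' : {set 'I_m}) :
    measurable_fun setT (fun t => (\prod_(i in K') r t (tnth t i))%:E).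
  apply/measurable_EFinP; exact: measurable_prod_tnth.
move: {2}#|K| (erefl #|K|) => k; elim: k K => [|k IH] K cK KS.
  rewrite (cards0_eq cK); under eq_integral do rewrite big_set0.
  by rewrite integral_cst// mul1e; exact: probability_le1.
have /card_gt0P[i iK] : (0 < #|K|)%N by rewrite cK.
have {}IH : \int[nu]_t (\prod_(j in K :\ i) r t (tnth t j))%:E <= 1.
  apply: IH; last exact: fintype.subset_trans (subD1set K i) KS.
  by move: cK; rewrite (cardsD1 i) iK => -[].
have h0 (K' : {set 'I_m}) t : (0 <= \prod_(j in K') r t (tnth t j))%R.
  by apply: prodr_ge0 => j _; exact: r0.
have iS : i \in S by exact: (fintype.subsetP KS).
apply: le_trans IH.
rewrite (integral_resample i nuQ (mh K)); last by move=> t; rewrite lee_fin.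
have mrt t : measurable_fun setT (r t).
  apply: (@measurableT_comp _ _ _ _ _ _ (fun z : m.-tuple T * T => r z.1 z.2)
    _ (fun x => (t, x))) => //.
  exact: pair1_measurable.
(* [rS] keeps the function [r] fixed under the redraw, so only the factor at [i] depends on [x]. *)
have resE t : \int[Q]_x (\prod_(j in K) r (resample i (t, x))
      (tnth (resample i (t, x)) j))%:E =
    (\prod_(j in K :\ i) r t (tnth t j))%:E * \int[Q]_x (r t x)%:E.
  rewrite -ge0_integralZl//; last 3 first.
  - exact/measurable_EFinP.
  - by move=> x _; rewrite lee_fin.
  - by rewrite lee_fin.
  apply: eq_integral => x _; rewrite -EFinM (big_setD1 i)//= mulrC.
  congr (_ * _)%:E.
    apply: eq_bigr => j; rewrite !inE => /andP[/negbTE ji _].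
    by rewrite tnth_mktuple ji rS.
  by rewrite tnth_mktuple eqxx rS.
apply: ge0_le_integral => //.
- by move=> t _; apply: integral_ge0 => x _; rewrite lee_fin.
- apply: (@measurable_fun_fubini_tonelli_F _ _ _ _ _ Q (fun z =>
    (\prod_(j in K) r (resample i z) (tnth (resample i z) j))%:E)).
  + exact: (measurableT_comp (mh K) (measurable_resample i)).
  + by move=> z; rewrite lee_fin.
- by move=> t _; rewrite resE -[leRHS]mule1 lee_wpmul2l// lee_fin.
Qed.
End tuple_law.

(** * Error probability for a fixed split *)

Section split_error.
Local Open Scope ereal_scope.
Context d (T : measurableType d) (R : realType) (m : nat).

Lemma is_iid_law_marginal (nu : probability (m.-tuple T) R)
    (Q : probability T R) (i : 'I_m) (A : set T) :
  is_iid_law nu Q -> measurable A -> nu [set t | A (tnth t i)] = Q A.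
Proof.
move=> nuQ mA; pose A' j := if j == i then A else setT.
rewrite (_ : [set t | _] = box A'); last first.
  apply/seteqP; split=> t /=; last by move=> /(_ i); rewrite /A' eqxx.
  by move=> At j; rewrite /A'; case: eqP => [->|].
rewrite [LHS]nuQ/A'//; last by move=> j; case: ifP.
rewrite (bigD1 i)//= eqxx big1 ?mule1// => j /negbTE ->.
exact: probability_setT.
Qed.

Context (Theta : Type) (p : Theta -> T -> R).

Lemma measurable_likelihood (S : {set 'I_m}) (th : m.-tuple T -> Theta) :
  measurable_fun [set: m.-tuple T * T] (fun z => p (th z.1) z.2) ->
  measurable_fun setT (fun t => likelihood p (tnth t) S (th t)).
Proof.
by move=> mp; exact: (@measurable_prod_tnth _ _ _ _ (fun t => p (th t))).
Qed.

Context (alpha : R) (S : {set 'I_m}) (theta0 : Theta).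
Variable thetahat : m.-tuple T -> Theta.

(** The event that [theta0] falls outside the confidence set, free of denominators so that a zero
    likelihood needs no convention. *)
Definition rejection_region : set (m.-tuple T) :=
  [set t | (likelihood p (tnth t) S theta0
            < alpha * likelihood p (tnth t) S (thetahat t))%R].

Hypothesis mp0 : measurable_fun setT (p theta0).
Hypothesis mphat :
  measurable_fun [set: m.-tuple T * T] (fun z => p (thetahat z.1) z.2).

Lemma measurable_rejection_region : measurable rejection_region.
Proof.
have mL0 : measurable_fun setT
    (fun t : m.-tuple T => likelihood p (tnth t) S theta0).
  apply: (@measurable_likelihood S (fun=> theta0)).
  exact: (measurableT_comp mp0).
rewrite -[X in measurable X]setTI.
apply: (measurable_fun_ltr mL0) => //.
apply: measurable_funM => //; exact: measurable_likelihood.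
Qed.

(** Markov's inequality for the product [h] of the ratios over [S]. The hypothesis on [resample]
    expresses that the estimate ignores the observations in [S]. *)
Lemma rejection_region_le (mu : {measure set T -> \bar R})
    (Q : Theta -> probability T R) (nu : probability (m.-tuple T) R) :
  (0 <= alpha)%R ->
  (forall theta, is_density mu (Q theta) (p theta)) ->
  is_iid_law nu (Q theta0) ->
  (forall i t x, i \in S -> thetahat (resample i (t, x)) = thetahat t) ->
  nu rejection_region <= alpha%:E.
Proof.
move=> alpha0 hp nuQ hatS.
have p0 theta x : (0 <= p theta x)%R by have [] := hp theta.
pose r t x := (p (thetahat t) x / p theta0 x)%R.
have r0 t x : (0 <= r t x)%R by exact: divr_ge0.
have mr : measurable_fun [set: m.-tuple T * T] (fun z => r z.1 z.2).
  by apply: measurable_fun_divr_ge0 => //; exact: (measurableT_comp mp0).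
have intr t : \int[Q theta0]_x (r t x)%:E <= 1.
  exact: integral_likelihood_ratio_le1 (hp _) (hp _).
have rS i t x : i \in S -> r (resample i (t, x)) = r t.
  by move=> iS; rewrite /r hatS.
pose h t := (\prod_(i in S) r t (tnth t i))%R.
have h0 t : (0 <= h t)%R by apply: prodr_ge0 => i _; exact: r0.
have mh : measurable_fun setT h.
  exact: measurable_prod_tnth.
have inth : \int[nu]_t (h t)%:E <= 1.
  exact: (integral_prod_le1 nuQ mr r0 intr rS).
have mE := measurable_rejection_region.
have mZ : measurable [set x | p theta0 x = 0%R].
  rewrite -[X in measurable X]setTI.
  exact: (mp0 measurableT (measurable_set1 0%R)).
(* Where [p theta0] vanishes the ratio is 0 by convention and the bound below could fail; this is
   confined to a null set. *)
have aeN : {ae nu, forall t : m.-tuple T, forall i, p theta0 (tnth t i) != 0%R}.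
  apply: filter_forall => i; exists [set t | p theta0 (tnth t i) = 0%R]; split.
  - rewrite -[X in measurable X]setTI.
    exact: (@measurable_tnth _ T m i measurableT _ mZ).
  - rewrite (is_iid_law_marginal i nuQ mZ); exact: density_null (hp _).
  - by move=> t /= /negP; rewrite negbK => /eqP.
rewrite -(setIT rejection_region) -integral_indic//.
(* Almost everywhere [alpha * h] dominates the indicator: on the region the quotient of likelihoods
   exceeds [1 / alpha]. *)
apply: (@le_trans _ _ (\int[nu]_t (alpha * h t)%:E)).
  apply: ae_ge0_le_integral => //.
  - exact/measurable_EFinP.
  - by move=> t _; rewrite lee_fin mulr_ge0.
  - by apply/measurable_EFinP; exact: measurable_funM.
  apply: filterS aeN => t tN _; rewrite lee_fin indicE.
  have [|_] := boolP (t \in _); last by rewrite mulr_ge0.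
  rewrite inE /rejection_region/= => tE.
  have -> : h t = (likelihood p (tnth t) S (thetahat t)
                   / likelihood p (tnth t) S theta0)%R.
    by rewrite /h /r big_split/= prodfV.
  rewrite mulrA ler_pdivlMr ?mul1r; first exact: ltW.
  by apply: prodr_gt0 => i _; rewrite lt_neqAle eq_sym tN p0.
under eq_integral do rewrite EFinM.
rewrite ge0_integralZl//; last 2 first.
- exact/measurable_EFinP.
- by move=> t _; rewrite lee_fin.
by rewrite -[leRHS]mule1 lee_wpmul2l// lee_fin.
Qed.

End split_error.

(** * Confidence set and profile likelihood for fixed data *)

Section profile.
Context (T Theta Psi : Type) (R : realType) (m : nat).
Variables (p : Theta -> T -> R) (g : Theta -> Psi) (alpha : R).
Variables (y : 'I_m -> T) (D0 : {set 'I_m}) (th : Theta).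
Hypothesis p0 : forall theta x, 0 <= p theta x.
Hypothesis alpha_gt0 : 0 < alpha.

Local Notation L := (likelihood p y D0).

Lemma likelihood_ge0 theta : 0 <= L theta.
Proof. by apply: prodr_ge0 => i _; exact: p0. Qed.

(** Clearing the denominator is also correct in the degenerate cases: for [b = +oo] both sides hold,
    and for [b = 0] both say [a = 0]. *)
Lemma EFin_div_leE (a : R) (b : \bar R) : 0 <= a -> (0 <= b)%E ->
  (a%:E / b <= (1 / alpha)%:E)%E = ((alpha * a)%:E <= b)%E.
Proof.
move=> a0; case: b => [b| |]//; last first.
  by move=> _; rewrite invey mule0 leey lee_fin divr_ge0 // ltW.
rewrite lee_fin => b0; rewrite inver; have [->|bN] := eqVneq b 0%R.
  rewrite lee_fin pmulr_rle0//; move: a0; rewrite le_eqVlt => /predU1P[<-|a0].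
    by rewrite mul0e lexx lee_fin divr_ge0// ltW.
  by rewrite gt0_muley ?lte_fin// leye_eq leNgt a0.
have b1 : (0 < b)%R by rewrite lt_neqAle eq_sym bN.
rewrite -EFinM !lee_fin ler_pdivrMr// mulrAC mul1r.
by rewrite ler_pdivlMr// mulrC.
Qed.

Lemma profile_likelihood_ge theta :
  ((L theta)%:E <= profile_likelihood p g y D0 (g theta))%E.
Proof. by apply: ereal_sup_ubound; exists theta. Qed.

Lemma profile_likelihood_ge0 psi : range g psi ->
  (0 <= profile_likelihood p g y D0 psi)%E.
Proof.
move=> [theta _ <-]; apply: le_trans (profile_likelihood_ge theta).
by rewrite lee_fin likelihood_ge0.
Qed.

Lemma split_LRT_setE theta :
  split_LRT_set p alpha y D0 th theta = (alpha * L th <= L theta).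
Proof.
rewrite /split_LRT_set/= EFin_div_leE ?likelihood_ge0//.
by rewrite lee_fin likelihood_ge0.
Qed.

Lemma profile_set_sub :
  profile_set p g alpha y D0 th `<=` profile_LRT_set p g alpha y D0 th.
Proof.
move=> _ [theta [+ <-]]; rewrite split_LRT_setE => Ltheta.
have gr : range g (g theta) by exists theta.
split=> //.
rewrite /profile_ratio EFin_div_leE ?likelihood_ge0 ?profile_likelihood_ge0//.
by apply: le_trans (profile_likelihood_ge theta); rewrite lee_fin.
Qed.

(** Only the boundary value of the ratio calls for a maximiser: if the supremum strictly exceeds
    [alpha * L th], then so does the likelihood at some point of the fibre. *)
Lemma profile_LRT_set_sub :
  (forall psi, range g psi ->
     profile_ratio p g y D0 th psi = (1 / alpha)%:E ->
     profile_attained p g y D0 psi) ->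
  profile_LRT_set p g alpha y D0 th `<=` profile_set p g alpha y D0 th.
Proof.
move=> att psi [gpsi]; have L0 := profile_likelihood_ge0 gpsi.
move=> ratio_le.
have := ratio_le; rewrite /profile_ratio EFin_div_leE ?likelihood_ge0// => Lle.
suff [theta gtheta Ltheta] :
    exists2 theta, g theta = psi & alpha * L th <= L theta.
  by exists theta; split => //; rewrite split_LRT_setE.
(* With a zero numerator the ratio is 0 and not [1 / alpha], so [att] cannot be invoked; any point
   of the fibre serves. *)
have [Lth0|LthN] := eqVneq (L th) 0.
  case: gpsi => theta _ gtheta; exists theta => //.
  by rewrite Lth0 mulr0 likelihood_ge0.
move: Lle; rewrite le_eqVlt => /orP[/eqP Leq|]; last first.
  move=> /ereal_sup_gt[_ [theta gtheta <-]]; rewrite lte_fin => /ltW.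
  by exists theta.
(* In the case of equality the ratio is exactly [1 / alpha], so a maximiser exists in the fibre. *)
have [|theta gtheta Ltheta] := att psi gpsi.
  rewrite /profile_ratio -Leq inver mulf_eq0 gt_eqF//= (negbTE LthN) -EFinM.
  by rewrite invfM mulrCA divff// mulr1 div1r.
by exists theta => //; rewrite -lee_fin Leq Ltheta.
Qed.

End profile.

(** * The data as one random tuple *)

Section data_tuple.
Context d dT (Omega : measurableType d) (T : measurableType dT) (R : realType).
Context (P : probability Omega R) (m : nat) (Y : 'I_m -> {RV P >-> T}).

Definition data_tuple (w : Omega) : m.-tuple T := [tuple Y i w | i < m].

Lemma measurable_data_tuple : measurable_fun setT data_tuple.
Proof.
apply/measurable_fun_tnthP => i.
rewrite (_ : _ \o _ = Y i); first exact: measurable_funPT.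
by apply/funext => w; rewrite /= tnth_mktuple.
Qed.

HB.instance Definition _ :=
  isMeasurableFun.Build _ _ _ _ data_tuple measurable_data_tuple.

Lemma data_tuple_iid (Q : probability T R) :
  iid_from Y Q -> is_iid_law (distribution P data_tuple) Q.
Proof.
move=> [indY lawY] A mA.
transitivity (P (\bigcap_(i in [set` [set: 'I_m]%SET]) (Y i @^-1` A i))).
  congr (P _); apply/seteqP; split=> w /= wA i.
    by move=> _; have := wA i; rewrite tnth_mktuple.
  by rewrite tnth_mktuple; apply: wA; rewrite /= inE.
rewrite indY//; apply: eq_big => [i|i _]; first by rewrite inE.
by rewrite -(lawY i).
Qed.

Lemma tnth_data_tuple w : tnth (data_tuple w) = fun i => Y i w.
Proof. by apply/funext => i; rewrite tnth_mktuple. Qed.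

End data_tuple.

(** * The estimate as a function of the whole tuple *)

Section estimator.
Context d (T : measurableType d) (R : realType) (Theta : Type).
Context (p : Theta -> T -> R) (n : nat).
Variable est : {set 'I_(2 * n)} -> seq T -> Theta.

(** [S] stands for a fixed value of [D0], so the estimate reads only the complement. *)
Definition tuple_estimate (S : {set 'I_(2 * n)}) (t : (2 * n).-tuple T) :=
  estimate est (tnth t) (~: S)%SET.

(** The separation of the estimate from the group [D0], in the form that [rejection_region_le] asks
    for. *)
Lemma tuple_estimate_resample (S : {set 'I_(2 * n)}) i t x :
  i \in S -> tuple_estimate S (resample i (t, x)) = tuple_estimate S t.
Proof.
move=> iS; congr (est _ _); apply/eq_in_map => j.
rewrite mem_enum inE => jS; rewrite tnth_mktuple.
by case: eqP jS => // ->; rewrite iS.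
Qed.

Lemma measurable_tuple_estimate (S : {set 'I_(2 * n)}) :
  measurable_estimator p est -> #|S| = n ->
  measurable_fun [set: (2 * n).-tuple T * T]
    (fun z => p (tuple_estimate S z.1) z.2).
Proof.
move=> mest cS.
have cSC : #|~: S|%SET = n.
  by apply/eqP; rewrite -(eqn_add2l #|S|) cardsC card_ord cS mul2n addnn.
have sz : size (enum (~: S)%SET) == n by rewrite -cardE cSC.
(* The increasing list of the complement selects an [n]-tuple from the data, the format in which
   [measurable_estimator] is stated. *)
pose e : n.-tuple 'I_(2 * n) := Tuple sz.
pose u (t : (2 * n).-tuple T) : n.-tuple T := [tuple tnth t (tnth e k) | k < n].
have uE t : u t = [seq tnth t i | i <- enum (~: S)%SET] :> seq T.
  rewrite -[RHS]/(val (map_tuple (tnth t) e)); congr val.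
  by apply: eq_from_tnth => k; rewrite tnth_mktuple tnth_map.
have mu : measurable_fun setT u.
  apply/measurable_fun_tnthP => k.
  rewrite (_ : _ \o _ = fun t => tnth t (tnth e k)); last first.
    by apply/funext => t; rewrite /= tnth_mktuple.
  exact: measurable_tnth.
rewrite (_ : (fun z => _) =
    (fun z : n.-tuple T * T => p (est (~: S)%SET z.1) z.2) \o
    (fun z : (2 * n).-tuple T * T => (u z.1, z.2))); last first.
  by apply/funext => z; rewrite /= uE.
apply: measurableT_comp; first exact: mest.
apply: measurable_fun_pair; last exact: measurable_snd.
exact: (measurableT_comp mu).
Qed.

End estimator.

(** * Averaging over the random split, and the conclusion *)

Theorem mainTheorem3
    (R : realType) (alpha : R) (halpha : 0 < alpha < 1)
    (dT : measure_display) (T : measurableType dT)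
    (mu : {measure set T -> \bar R})
    (Theta : Type) (Q : Theta -> probability T R) (p : Theta -> T -> R)
    (hp : forall theta, is_density mu (Q theta) (p theta))
    (Psi : Type) (g : Theta -> Psi)
    (thetastar : Theta)
    (d : measure_display) (Omega : measurableType d) (P : probability Omega R)
    (n : nat) (Y : 'I_(2 * n) -> {RV P >-> T})
    (hY : iid_from Y (Q thetastar))
    (D0 : Omega -> {set 'I_(2 * n)}) (hD0 : independent_split Y D0)
    (est : {set 'I_(2 * n)} -> seq T -> Theta)
    (hest : measurable_estimator p est) :
  let y (w : Omega) := fun i => Y i w in
  let D1 (w : Omega) := (~: D0 w)%SET in
  let hattheta1 (w : Omega) := estimate est (y w) (D1 w) in
  let B (w : Omega) := profile_set p g alpha (y w) (D0 w) (hattheta1 w) in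
  let Bdag (w : Omega) := profile_LRT_set p g alpha (y w) (D0 w) (hattheta1 w) in
  [/\ ((1 - alpha)%:E <= inner_probability P [set w | B w (g thetastar)])%E,
      forall w, B w `<=` Bdag w &
      forall w,
        (forall psi, range g psi ->
           profile_ratio p g (y w) (D0 w) (hattheta1 w) psi = (1 / alpha)%:E ->
           profile_attained p g (y w) (D0 w) psi) ->
        B w = Bdag w].
Proof.
move=> y D1 hattheta1 B Bdag.
have [alpha0 _] := andP halpha.
have p0 theta x : 0 <= p theta x by have [] := hp theta.
split; [|by move=> w; exact: profile_set_sub|]; last first.
  move=> w att; apply/seteqP; split; first exact: profile_set_sub.
  exact: profile_LRT_set_sub.
have [cD mD indD] := hD0.
(* With the split fixed to [S], the estimate is a deterministic function of the data tuple; [bad S]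
   is the failure event on that split. *)
pose rej S := rejection_region p alpha S thetastar (tuple_estimate est S).
pose bad S := D0 @^-1` [set S] `&` data_tuple Y @^-1` rej S.
pose half : set {set 'I_(2 * n)} := [set S | #|S| = n].
have mrej S : half S -> measurable (rej S).
  move=> cS; apply: measurable_rejection_region.
    by have [] := hp thetastar.
  exact: measurable_tuple_estimate.
have mbad S : half S -> measurable (bad S).
  move=> cS; apply: measurableI => //; rewrite -[X in measurable X]setTI.
  by apply: measurable_data_tuple => //; exact: mrej.
have fhalf : finite_set half by exact: finite_finset.
(* A finite union of measurable events; its complement is a measurable event inside the confidence
   event, hence bounds the inner probability from below. *)
pose E := \bigcup_(S in half) bad S.
have mE : measurable E by apply: fin_bigcup_measurable.
have tD : trivIset half (fun S => D0 @^-1` [set S]).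
  by move=> S1 S2 _ _ [w [/= <- <-]].
(* Total probability over the disjoint values of [D0]. *)
have PE : (P E <= alpha%:E)%E.
  rewrite /E measure_fin_bigcup//; last exact: trivIset_setIr.
  apply: (@le_trans _ _ (\sum_(S \in half) alpha%:E * P (D0 @^-1` [set S]))%E).
    apply: lee_fsum => // S cS.
    (* The split is independent of the data, so conditioning on its value does not disturb the
       i.i.d. law. *)
    rewrite /bad [leLHS](indD S (rej S) (mrej S cS)) muleC.
    apply: lee_wpmul2r => //.
    apply: (@rejection_region_le _ _ _ _ _ p alpha S thetastar
      (tuple_estimate est S) _ _ mu Q (distribution P (data_tuple Y))) => //.
    - by have [] := hp thetastar.
    - exact: measurable_tuple_estimate.
    - exact: ltW.
    - exact: data_tuple_iid.
    - by move=> i t x iS; exact: tuple_estimate_resample.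
  rewrite -ge0_mule_fsumr// -measure_fin_bigcup//; last first.
    by move=> S _; exact: mD.
  rewrite -[leRHS]mule1 lee_wpmul2l ?lee_fin ?(ltW alpha0)//.
  by apply: probability_le1; apply: fin_bigcup_measurable => // S _; exact: mD.
apply: (@le_trans _ _ (P (~` E))).
  by rewrite probability_setC// EFinB leeB.
apply: ereal_sup_ubound; exists (~` E) => //; split; first exact: measurableC.
(* Off [E] the true parameter itself is the point of [split_LRT_set] in the fibre over
   [g thetastar]. *)
move=> w Ew; exists thetastar; split => //.
rewrite split_LRT_setE// leNgt; apply/negP => wE; apply: Ew.
exists (D0 w); first exact: cD.
split => //; rewrite /rej /rejection_region/= /tuple_estimate.
by rewrite tnth_data_tuple.
Qed.
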